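(* Let $n>k>t\ge1$ be integers, let $\mathcal F\subset\binom{[n]}{k}$ be a shifted pseudo $t$-intersecting family of width $w=w_t(\mathcal F)$. Then for every integer $0<j\le t$, $$|\partial_R^j\mathcal F|\ \ge\ |\mathcal F|\,\frac{\binom{t+2w}{t-j+w}}{\binom{t+2w}{t+w}}.$$
   Context: $[n]=\{1,\dots,n\}$, and $\binom{Y}{k}$ is the collection of all $k$-element subsets of $Y$. Shifted: for $k$-sets $A=\{a_1<\dots<a_k\}$, $B=\{b_1<\dots<b_k\}$ write $A\prec B$ iff $a_i\le b_i$ for all $1\le i\le k$; $\mathcal F\subset\binom{[n]}{k}$ is shifted if $A\prec B$ and $B\in\mathcal F$ always imply $A\in\mathcal F$. Pseudo $t$-intersecting: for every $F\in\mathcal F$ there is an integer $h$, $0\le h\le k-t$, with $|F\cap[t+2h]|\ge t+h$. Width $w_t(\mathcal F)$: the minimum integer $w\ge 0$ such that for every $F\in\mathcal F$ there is an $h$ with $0\le h\le w$ and $|F\cap[t+2h]|\ge t+h$. Height of $F\in\mathcal F$: $h(F)=\max\{h: 0\le h\le w_t(\mathcal F),\ |F\cap[t+2h]|\ge t+h\}$. Tail of $F$: $T(F)=F\setminus[t+2h(F)]$. Restricted $j$'th shadow of $F\in\mathcal F$: $\partial_R^jF=\{G\in\binom{F}{k-j}: T(F)\subset G\}$; and $\partial_R^j\mathcal F=\bigcup_{F\in\mathcal F}\partial_R^jF$. *)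

(* Defs.v *)
From mathcomp Require Import all_boot.

Set Implicit Arguments.
Unset Strict Implicit.
Unset Printing Implicit Defensive.

(* The ground set [n] = {1, ..., n} is encoded as 'I_n, with i : 'I_n standing
   for the integer i + 1; hence [m] inside [n] is the set of all i < m (which
   is the whole of 'I_n as soon as n <= m). *)

Definition init_seg (n m : nat) : {set 'I_n} := [set i : 'I_n | i < m].

Definition elems (n : nat) (A : {set 'I_n}) : seq nat :=
  [seq nat_of_ord i | i <- enum A].

(* enum lists a set of ordinals in increasing order, so that the i-th entry of
   elems A (counted from 0) is a_{i+1} - 1 when A = {a_1 < ... < a_k}. *)
Lemma elems_sorted (n : nat) (A : {set 'I_n}) : sorted ltn (elems A).
Proof.
rewrite /elems; apply: (subseq_sorted ltn_trans (s2 := iota 0 n)).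
  by rewrite -val_enum_ord map_subseq // enumT filter_subseq.
exact: iota_ltn_sorted.
Qed.

Definition prec (n k : nat) (A B : {set 'I_n}) : Prop :=
  forall i, i < k -> nth 0 (elems A) i <= nth 0 (elems B) i.

Definition k_uniform (n k : nat) (F : {set {set 'I_n}}) : Prop :=
  forall A, A \in F -> #|A| = k.

Definition shifted (n k : nat) (F : {set {set 'I_n}}) : Prop :=
  forall A B : {set 'I_n}, #|A| = k -> #|B| = k ->
    prec k A B -> B \in F -> A \in F.

Definition dense_at (n t h : nat) (A : {set 'I_n}) : bool :=
  t + h <= #|A :&: init_seg n (t + 2 * h)|.

Definition pseudo_intersecting (n k t : nat) (F : {set {set 'I_n}}) : Prop :=
  forall A, A \in F -> exists2 h, h <= k - t & dense_at t h A.

Definition width_le (n t : nat) (F : {set {set 'I_n}}) (w : nat) : bool :=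
  [forall A in F, [exists h : 'I_w.+1, dense_at t h A]].

(* The least w with width_le t F w. Searching up to n suffices, as dense_at t h
   forces h <= n; see widthP. *)
Definition width (n t : nat) (F : {set {set 'I_n}}) : nat :=
  find (width_le t F) (iota 0 n.+1).

Lemma width_leP (n t : nat) (F : {set {set 'I_n}}) (w : nat) :
  reflect (forall A, A \in F -> exists2 h, h <= w & dense_at t h A)
          (width_le t F w).
Proof.
apply: (iffP forall_inP) => H A /H => [/existsP[h hA]|[h hw hA]].
  by exists (nat_of_ord h) => //; rewrite -ltnS.
by apply/existsP; exists (Ordinal (hw : h < w.+1)).
Qed.

Lemma widthP (n k t : nat) (F : {set {set 'I_n}}) :
  pseudo_intersecting k t F ->
  width_le t F (width t F) /\ forall w, width_le t F w -> width t F <= w.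
Proof.
move=> psF.
have le_n h (A : {set 'I_n}) : dense_at t h A -> h <= n.
  move=> hA; apply: leq_trans (leq_addl t h) _; apply: leq_trans hA _.
  by rewrite -[X in _ <= X]card_ord max_card.
have wn : has (width_le t F) (iota 0 n.+1).
  apply/hasP; exists n; first by rewrite mem_iota add0n ltnSn.
  by apply/width_leP => A /psF[h _ hA]; exists h => //; exact: le_n hA.
have lt_w : width t F < n.+1 by rewrite -[X in _ < X](size_iota 0 n.+1) -has_find.
split; first by have := nth_find 0 wn; rewrite nth_iota.
move=> w ww; rewrite leqNgt; apply/negP => w_lt.
have := before_find 0 w_lt.
by rewrite nth_iota ?(ltn_trans w_lt lt_w) // add0n ww.
Qed.

(* For A in a pseudo t-intersecting F the maximum ranges over a nonempty set,
   so that the default value 0 of \max plays no role. *)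
Definition height (n t : nat) (F : {set {set 'I_n}}) (A : {set 'I_n}) : nat :=
  \max_(h < (width t F).+1 | dense_at t h A) h.

Definition tail (n t : nat) (F : {set {set 'I_n}}) (A : {set 'I_n}) :
    {set 'I_n} :=
  A :\: init_seg n (t + 2 * height t F A).

Definition restricted_shadow1 (n k t j : nat) (F : {set {set 'I_n}})
    (A : {set 'I_n}) : {set {set 'I_n}} :=
  [set G : {set 'I_n} | [&& G \subset A, #|G| == k - j & tail t F A \subset G]].

Definition restricted_shadow (n k t j : nat) (F : {set {set 'I_n}}) :
    {set {set 'I_n}} :=
  \bigcup_(A in F) restricted_shadow1 k t j F A.

(* Main.v *)
Require Import Defs.
From mathcomp Require Import all_boot all_order all_algebra.
From mathcomp Require Import zify.
Import Order.TTheory GRing.Theory Num.Theory.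
Local Open Scope ring_scope.

Set Implicit Arguments.
Unset Strict Implicit.

(** Count the pairs (A, G) with A in F and G in the restricted shadow of A.
    If G lies below both A and B, then A and B agree with G beyond
    [t + 2 max (h A) (h B)], hence meet that segment in equally many points;
    maximality of the heights then forces h A = h B =: h.  So at most
    'C(h + j, j) sets lie above G, while each set of height h has at least
    'C(t + h, j) sets below it, and the quotient of these two numbers is
    nondecreasing in h <= w because j <= t. *)

Lemma card_init_seg (n m : nat) : (#|init_seg n m| <= m)%N.
Proof.
rewrite cardE -(size_map val) -[leqRHS](size_iota 0).
apply: uniq_leq_size; first by rewrite (map_inj_uniq val_inj) enum_uniq.
by move=> _ /mapP[i + ->]; rewrite mem_enum inE mem_iota.
Qed.

Section Height.
Variables (n k t : nat) (F : {set {set 'I_n}}).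
Implicit Types (A : {set 'I_n}) (h : nat).

Lemma height_ge A h : (h <= width t F)%N -> dense_at t h A ->
  (h <= height t F A)%N.
Proof.
rewrite -ltnS => hw hA.
exact: (@leq_bigmax_cond _ (fun h : 'I__ => dense_at t h A) val (Ordinal hw)).
Qed.

Lemma height_le_width A : (height t F A <= width t F)%N.
Proof. by apply/bigmax_leqP => h _; rewrite -ltnS. Qed.

(** By minimality of the search defining the width, some [h <= width t F] is dense for [A], so the
    maximum runs over a nonempty range and is attained. *)
Lemma dense_at_height A : pseudo_intersecting k t F -> A \in F ->
  dense_at t (height t F A) A.
Proof.
move=> /widthP[/width_leP wF _] /wF[h hw hA].
rewrite /height.
have [|h' hA' ->] := @eq_bigmax_cond _
  (fun h : 'I_(width t F).+1 => dense_at t h A) (@nat_of_ord _).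
  by apply/card_gt0P; exists (Ordinal (hw : (h < (width t F).+1)%N)).
exact: hA'.
Qed.

End Height.

Section RestrictedShadow.
Variables (n k t j : nat) (F : {set {set 'I_n}}).
Hypotheses (jk : (j <= k)%N) (F_unif : k_uniform k F)
  (F_pseudo : pseudo_intersecting k t F).
Implicit Types A B G : {set 'I_n}.
Local Notation ht := (height t F).
Local Notation shadow1 := (restricted_shadow1 k t j F).
Local Notation seg h := (init_seg n (t + 2 * h)).

(** [G] lies inside [A] and contains its tail, which already holds every point of [A] beyond [seg h]
    once [ht A <= h]. *)
Lemma restricted_shadow1_setD A G h : G \in shadow1 A -> (ht A <= h)%N ->
  A :\: seg h = G :\: seg h.
Proof.
rewrite inE => /and3P[GA _ TG] hA; apply/eqP; rewrite eqEsubset (setSD _ GA) andbT.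
apply/subsetP => x; rewrite !inE -leqNgt => /andP[xh xA]; rewrite xh /=.
by apply: (subsetP TG); rewrite /tail !inE xA -leqNgt andbT; lia.
Qed.

Lemma height_restricted_shadow1_le A B G : A \in F -> B \in F ->
  G \in shadow1 A -> G \in shadow1 B -> (ht B <= ht A)%N.
Proof.
move=> AF BF GA GB; case/orP: (leq_total (ht B) (ht A)) => // hAB.
apply: height_ge; first exact: height_le_width.
have /= := dense_at_height F_pseudo BF; rewrite /dense_at => /leq_trans; apply.
have eqD := etrans (restricted_shadow1_setD GA hAB)
                   (esym (restricted_shadow1_setD GB (leqnn _))).
(* Both sets have [k] points and agree outside the segment, so they meet it equally often and the
   density of [B] passes to [A]. *)
have := cardsID (seg (ht B)) A; have := cardsID (seg (ht B)) B.
by rewrite eqD (F_unif AF) (F_unif BF); lia.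
Qed.

Lemma height_restricted_shadow1 A B G : A \in F -> B \in F ->
  G \in shadow1 A -> G \in shadow1 B -> ht A = ht B.
Proof.
by move=> AF BF GA GB; apply/eqP; rewrite eqn_leq !(@height_restricted_shadow1_le _ _ G).
Qed.

(** Deleting any [j] points of [A] inside [seg (ht A)] keeps the tail, and at least [t + ht A]
    points are available there. Distinct deletions leave distinct sets. *)
Lemma card_restricted_shadow1 A : A \in F ->
  ('C(t + ht A, j) <= #|shadow1 A|)%N.
Proof.
move=> AF; have := dense_at_height F_pseudo AF; rewrite /dense_at => hA.
apply: leq_trans (leq_bin2l _ hA) _; rewrite -cards_draws.
rewrite -(card_in_imset (f := fun D => A :\: D)) => [|D E]; last first.
  rewrite !inE => /andP[/subsetIP[DA _] _] /andP[/subsetIP[EA _] _] /= eqDE.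
  by rewrite -(setIidPr DA) -(setIidPr EA) -(set0U (A :&: D)) -(setDv A) -setDDr eqDE setDDr
      setDv set0U.
apply/subset_leq_card/subsetP => _ /imsetP[D + ->].
rewrite !inE => /andP[/subsetIP[DA DS] /eqP cD].
by rewrite subsetDl cardsDS // cD (F_unif AF) eqxx setDS.
Qed.

(** All such [B] share the height of [A], so [B] is recovered from [G] and the [j]-set [B :\: G],
    which lies in [seg (ht A) :\: G]. *)
Lemma card_restricted_shadow1_above A G : A \in F -> G \in shadow1 A ->
  (#|[set B in F | G \in shadow1 B]| <= 'C(ht A + j, j))%N.
Proof.
move=> AF GA.
have sub B : B \in F -> G \in shadow1 B ->
    [&& G \subset B, B :\: G \subset seg (ht A) & #|B :\: G| == j].
  move=> BF GB; have := GB; rewrite inE => /and3P[sGB /eqP cG TG].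
  rewrite (height_restricted_shadow1 AF BF GA GB).
  rewrite sGB cardsDS // cG (F_unif BF) subKn // eqxx andbT /=.
  by rewrite subDset setUC -subDset.
(* [G] has [j] points fewer than [A] in the segment, hence at least [t + ht A - j] of its at most
   [t + 2 * ht A] points. *)
have cS : (#|seg (ht A) :\: G| <= ht A + j)%N.
  have := dense_at_height F_pseudo AF; rewrite /dense_at => hA.
  have := restricted_shadow1_setD GA (leqnn _).
  have := GA; rewrite inE => /and3P[_ /eqP cG _] eqD.
  have := cardsID (seg (ht A)) A; have := cardsID (seg (ht A)) G.
  have := cardsID G (seg (ht A)); have := card_init_seg n (t + 2 * ht A).
  by rewrite eqD cG (F_unif AF) (setIC (seg _)); lia.
apply: leq_trans (leq_bin2l _ cS); rewrite -cards_draws.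
have inj : {in [set B in F | G \in shadow1 B] &, injective (fun B => B :\: G)}.
  move=> B C /setIdP[BF GB] /setIdP[CF GC] /= eqBC.
  have /and3P[GsB _ _] := sub _ BF GB; have /and3P[GsC _ _] := sub _ CF GC.
  by rewrite -(setID B G) -(setID C G) eqBC (setIidPr GsB) (setIidPr GsC).
rewrite -(card_in_imset inj).
apply/subset_leq_card/subsetP => _ /imsetP[B + ->].
move=> /setIdP[BF GB]; have /and3P[_ sS cB] := sub _ BF GB.
by rewrite inE cB andbT subsetD sS disjoint_sym disjoints_subset setCD subsetUr.
Qed.

End RestrictedShadow.

Lemma leq_bin_ratio (t j h w : nat) : (j <= t)%N -> (h <= w)%N ->
  ('C(h + j, j) * 'C(t + w, j) <= 'C(w + j, j) * 'C(t + h, j))%N.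
Proof.
move=> jt /subnKC <-; elim: (w - h)%N => [|d IH]; first by rewrite addn0 mulnC.
move: (h + d)%N IH (addnS h d) => v IH ->.
have e1 := mul_bin_down (t + v).+1 j; have e2 := mul_bin_down (v + j).+1 j.
rewrite /= (_ : (v + j).+1 - j = v.+1)%N in e2; last by lia.
(* The right side exceeds the left by [j * (t - j)]; this is where [j <= t] enters the induction on
   [w - h]. *)
have le_coef : (v.+1 * (t + v).+1 <= (v + j).+1 * ((t + v).+1 - j))%N by nia.
have pos : (0 < v.+1 * ((t + v).+1 - j))%N by rewrite muln_gt0; lia.
rewrite addnS addSn -(leq_pmul2l pos).
have := leq_mul le_coef IH.
rewrite /= in e1.
rewrite (mulnACA v.+1) (mulnACA v.+1 _ 'C(h + j, j)) -e1.
rewrite (mulnACA (v + j).+1 _ 'C(v + j, j)) e2.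
by rewrite (mulnACA v.+1 _ _ 'C(t + h, j)).
Qed.

(** In factorials both quotients equal [(t + w)! w! / ((t - j + w)! (w + j)!)]. *)
Lemma bin_shift_ratio (t j w : nat) : (j <= t)%N ->
  'C(t + 2 * w, t - j + w)%:R / 'C(t + 2 * w, t + w)%:R
    = 'C(t + w, j)%:R / 'C(w + j, j)%:R :> rat.
Proof.
move=> jt.
have f1 : ('C(t + 2 * w, t - j + w) * ((t - j + w)`! * (w + j)`!) = (t + 2 * w)`!)%N.
  by rewrite (_ : w + j = t + 2 * w - (t - j + w))%N ?bin_fact //; lia.
have f2 : ('C(t + 2 * w, t + w) * ((t + w)`! * w`!) = (t + 2 * w)`!)%N.
  by rewrite [in w`!](_ : w = t + 2 * w - (t + w))%N ?bin_fact //; lia.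
have f3 : ('C(t + w, j) * (j`! * (t - j + w)`!) = (t + w)`!)%N.
  by rewrite (_ : t - j + w = t + w - j)%N ?bin_fact //; lia.
have f4 : ('C(w + j, j) * (j`! * w`!) = (w + j)`!)%N.
  by rewrite [in w`!](_ : w = w + j - j)%N ?bin_fact //; lia.
have nz1 : 'C(t + 2 * w, t + w)%:R != 0 :> rat.
  by rewrite pnatr_eq0 -lt0n bin_gt0; lia.
have nz2 : 'C(w + j, j)%:R != 0 :> rat by rewrite pnatr_eq0 -lt0n bin_gt0; lia.
apply/eqP; rewrite eqr_div // -!natrM eqr_nat.
have pos : (0 < j`! * w`! * (t - j + w)`!)%N by rewrite !muln_gt0 !fact_gt0.
rewrite -(eqn_pmul2r pos); move: f1; rewrite -f4 -{}f2 -f3 => f1.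
by apply/eqP; nia.
Qed.

(* Each x in X spreads a unit of weight evenly over N x. *)
Lemma double_count_ratio (U V : finType) (X : {set U}) (N : U -> {set V})
    (r : rat) :
  (forall x, x \in X -> (0 < #|N x|)%N) ->
  (forall y, \sum_(x in X | y \in N x) (r / #|N x|%:R) <= 1) ->
  #|X|%:R * r <= #|\bigcup_(x in X) N x|%:R.
Proof.
move=> N_gt0 le1.
have -> : #|X|%:R * r = \sum_(x in X) \sum_(y in N x) (r / #|N x|%:R).
  rewrite mulr_natl -sumr_const; apply: eq_bigr => x xX.
  by rewrite sumr_const -[RHS]mulr_natr divfK // pnatr_eq0 -lt0n N_gt0.
rewrite (exchange_big_dep (mem (\bigcup_(x in X) N x))) /=; last first.
  by move=> x y xX yN; apply/bigcupP; exists x.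
by rewrite -sum1_card natr_sum; apply: ler_sum => y _; apply: le1.
Qed.

Unset Implicit Arguments.
Set Strict Implicit.

Theorem theorem2p10 (n k t : nat) (F : {set {set 'I_n}})
    (hkn : (k < n)%N) (htk : (t < k)%N) (ht : (1 <= t)%N)
    (F_unif : k_uniform k F) (F_shifted : shifted k F)
    (F_pseudo : pseudo_intersecting k t F)
    (j : nat) (hj0 : (0 < j)%N) (hjt : (j <= t)%N) :
  let w := width t F in
  #|F|%:R * ('C(t + 2 * w, t - j + w)%:R / 'C(t + 2 * w, t + w)%:R)
    <= #|restricted_shadow k t j F|%:R :> rat.
Proof.
cbv zeta; set w := width t F; rewrite bin_shift_ratio //.
have jk : (j <= k)%N by lia.
have C_gt0 A : (0 < 'C(t + height t F A, j))%N by rewrite bin_gt0; lia.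
have lower := @card_restricted_shadow1 n k t j F F_unif F_pseudo.
apply: double_count_ratio => [A AF|G]; first exact: leq_trans (lower A AF).
have [/exists_inP[A AF GA]|/exists_inPn noA] :=
  boolP [exists A in F, G \in restricted_shadow1 k t j F A]; last first.
  by rewrite big_pred0 // => A; apply/negP => /andP[/noA/negP].
set r := _ / _.
have r_ge0 : 0 <= r by rewrite divr_ge0.
(* Every [B] above [G] has the height of [A], so one lower bound on the shadow sizes serves all the
   summands. *)
apply: (@le_trans _ _ (\sum_(B in F | G \in restricted_shadow1 k t j F B)
                        (r / 'C(t + height t F A, j)%:R))).
  apply: ler_sum => B /andP[BF GB].
  rewrite (height_restricted_shadow1 jk F_unif F_pseudo AF BF GA GB).
  by rewrite ler_wpM2l // lef_pV2 ?posrE ?ltr0n ?ler_nat ?lower // (leq_trans _ (lower B BF)).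
rewrite -big_set /= sumr_const.
have := @card_restricted_shadow1_above n k t j F jk F_unif F_pseudo A G AF GA.
have := @leq_bin_ratio t j (height t F A) w hjt (height_le_width _ _ _).
move=> ratio above.
(* Let [N] be the number of sets above [G]. Clearing denominators leaves [N * 'C(t + w, j) <= 'C(w +
   j, j) * 'C(t + height t F A, j)], which [above] and [ratio] give together. *)
rewrite -[leLHS]mulr_natr mulrAC ler_pdivrMr ?ltr0n // mul1r mulrAC.
rewrite ler_pdivrMr ?ltr0n ?bin_gt0 ?leq_addl // -!natrM ler_nat mulnC.
by rewrite [leqRHS]mulnC; apply: leq_trans ratio; rewrite leq_mul2r above orbT.
Qed.
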